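(* Let $J \subseteq \mathbb{R}$ be a non-degenerate interval, let $C \geq 0$ be a real number, and let $E \subseteq J$. Then $E$ is removable for the pointwise Lipschitz condition with constant $C$ on $J$ if and only if $E$ has no perfect subsets.
   Context: For a non-degenerate interval $J\subseteq\mathbb{R}$, a function $f:J\to\mathbb{R}$ and a point $x_0\in J$, the pointwise Lipschitz constant of $f$ at $x_0$ is \[ L(f,x_0)=\limsup_{x\to x_0}\frac{|f(x)-f(x_0)|}{|x-x_0|}\in[0,\infty], \] where the limsup is taken over $x\in J\setminus\{x_0\}$ (so it is one-sided if $x_0$ is an endpoint of $J$). A set $E\subseteq J$ is called removable for the pointwise Lipschitz condition with constant $C$ on $J$ if the following holds: whenever $f:J\to\mathbb{R}$ is continuous and $L(f,x)\leq C$ for all $x\in J\setminus E$, then $L(f,x)\leq C$ for all $x\in J$. A subset $A$ of $\mathbb{R}$ is a perfect set if $A$ is non-empty and closed in $\mathbb{R}$, and $A$ has no isolated points. (In particular, perfect sets are non-empty by convention.) *)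

(* Defs.v *)
From HB Require Import structures.
From mathcomp Require Import all_boot all_order all_algebra.
From mathcomp Require Import all_classical all_reals all_analysis.

Set Implicit Arguments.
Unset Strict Implicit.
Unset Printing Implicit Defensive.

Import Order.TTheory GRing.Theory Num.Theory.
Import numFieldNormedType.Exports.

Local Open Scope classical_set_scope.
Local Open Scope ring_scope.

(* A function J -> R is represented by a total function R -> R; the notions
   below depend only on its values on J. *)

(* The filter [within J x0^'] consists of the sets containing all points of
   J \ {x0} close to x0, so the limsup is one-sided at an endpoint of J. *)
Definition pointwise_lip {R : realType} (J : set R) (f : R -> R) (x0 : R)
    : \bar R :=
  limf_esup (fun x => (`|f x - f x0| / `|x - x0|)%:E) (within J x0^').

Definition removable_lip {R : realType} (J : set R) (C : R) (E : set R) : Prop :=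
  forall f : R -> R, {within J, continuous f} ->
    (forall x, (J `\` E) x -> (pointwise_lip J f x <= C%:E)%E) ->
    forall x, J x -> (pointwise_lip J f x <= C%:E)%E.

Definition nondegenerate_interval {R : realType} (J : set R) : Prop :=
  is_interval J /\ exists a b : R, [/\ J a, J b & a < b].

(* [perfect_set] alone also holds of the empty set. *)
Definition nonempty_perfect {R : realType} (A : set R) : Prop :=
  A !=set0 /\ perfect_set A.

(* Main.v *)
Require Import Defs.
From HB Require Import structures.
From mathcomp Require Import all_boot all_order all_algebra.
From mathcomp Require Import all_classical all_reals all_analysis.
From mathcomp Require Import lra.

Set Implicit Arguments.
Unset Strict Implicit.
Unset Printing Implicit Defensive.

Import Order.TTheory GRing.Theory Num.Theory.
Import numFieldNormedType.Exports.

Local Open Scope classical_set_scope.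
Local Open Scope ring_scope.

(** If [f] climbs with slope greater than [C] between two points, tilt it by an
    intermediate slope [C'] to get [G], still increasing between them, and let
    [phi x] be the infimum of [G] on [[x, +oo[]. The function [phi] is continuous,
    monotone and nonconstant, so the set of points near which it is not locally
    constant is a nonempty perfect set; at each such point [f] cannot have
    pointwise Lipschitz constant [<= C]. Hence a set without perfect subsets is
    removable. Conversely, a perfect subset carries a continuous nonconstant
    function that is locally constant off it (a Cantor function), and a large
    multiple of it defeats removability, because by the above (with the empty
    exceptional set) a pointwise bound [C] everywhere makes a function
    [C]-Lipschitz. *)

(** * Metric forms of neighbourhoods, continuity and perfect sets *)

Lemma nbhs_distP {R : realType} (x : R) (U : set R) :
  nbhs x U <-> exists2 d : R, 0 < d & forall y, `|y - x| < d -> U y.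
Proof.
split.
  move/nbhs_ballP => [d /= d0 dU]; exists d => // y yx; apply: dU.
  by rewrite /ball /= distrC.
move=> [d d0 dU]; apply/nbhs_ballP; exists d => //= y.
by rewrite /ball /= distrC => /dU.
Qed.

Lemma continuous_at_distP {R : realType} (f : R -> R) (x : R) :
  {for x, continuous f} <->
  forall e, 0 < e -> exists2 d, 0 < d & forall y, `|y - x| < d -> `|f y - f x| < e.
Proof.
split.
  move=> /cvgrPdist_lt fx e /fx /nbhs_distP[d d0 dP].
  by exists d => // y /dP; rewrite distrC.
move=> fx; apply/cvgrPdist_lt => e /fx[d d0 dP]; apply/nbhs_distP.
by exists d => // y /dP; rewrite distrC.
Qed.

Lemma perfect_setP {R : realType} (A : set R) :
  perfect_set A <-> closed A /\
    forall x d, A x -> 0 < d -> exists y, [/\ A y, y != x & `|y - x| < d].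
Proof.
split=> -[cA lA]; split=> //.
  move=> x d; rewrite -{1}lA => Ax d0.
  have /Ax[y [yx Ay yd]] : nbhs x [set y | `|y - x| < d] by apply/nbhs_distP; exists d.
  by exists y.
apply/seteqP; split=> x.
  by move=> /subset_limit_point; rewrite closure_id in cA; rewrite -cA.
move=> Ax U /nbhs_distP[d d0 dU].
by have [y [Ay yx /dU Uy]] := lA _ _ Ax d0; exists y.
Qed.

(** * The running infimum and its points of increase *)

Section RunningInfimum.
Context {R : realType} (G : R -> R).

Definition tail_inf (x : R) := inf [set G t | t in [set t | x <= t]].

Hypothesis G_lb : exists m, forall t, m <= G t.

Lemma tail_inf_le x t : x <= t -> tail_inf x <= G t.
Proof.
move=> xt; have [m mG] := G_lb.
by apply: ge_inf; [exists m => _ [s _ <-]|exists t].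
Qed.

Lemma lb_tail_inf x c : (forall t, x <= t -> c <= G t) -> c <= tail_inf x.
Proof. by move=> cG; apply: lb_le_inf; [exists (G x), x => /=|move=> _ [t /= /cG ? <-]]. Qed.

Lemma tail_inf_mono u v : u <= v -> tail_inf u <= tail_inf v.
Proof.
by move=> uv; apply: lb_tail_inf => t vt; apply: tail_inf_le; apply: le_trans vt.
Qed.

Lemma le_tail_inf u v c : (forall t, u <= t <= v -> c <= G t) ->
  c <= tail_inf v -> c <= tail_inf u.
Proof.
move=> cG cv; apply: lb_tail_inf => t ut; have [tv|vt] := leP t v.
  by apply: cG; rewrite ut.
by apply: (le_trans cv); apply: tail_inf_le; apply: ltW.
Qed.

Hypothesis G_cont : continuous G.

Lemma tail_inf_continuous : continuous tail_inf.
Proof.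
move=> x; apply/continuous_at_distP => e e0.
have /continuous_at_distP/(_ (e / 3))[|d d0 dG] := @G_cont x; first lra.
exists d => // y yx.
suff H u v : u <= v -> `|u - x| < d -> `|v - x| < d ->
    `|tail_inf u - tail_inf v| < e.
  have [xy|/ltW yx'] := leP x y; last by apply: H => //; rewrite subrr normr0.
  by rewrite distrC; apply: H => //; rewrite subrr normr0.
move=> uv ux vx; have le1 := tail_inf_mono uv.
(* On [[u, v]] the values of [G] stay within [2 * (e / 3)] of [G v], so extending the tail from [v]
   back to [u] lowers the infimum by no more than that. *)
have : tail_inf v - 2 * (e / 3) <= tail_inf u.
  apply: (@le_tail_inf _ v); last lra.
  move=> t /andP[ut tv].
  have tx : `|t - x| < d by move: ux vx; rewrite !ltr_norml; lra.
  have := dG _ tx; have := dG _ vx; have := tail_inf_le (lexx v).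
  rewrite !ltr_norml; lra.
by rewrite ltr_norml; lra.
Qed.

(* The support of the Stieltjes measure [d tail_inf]. *)
Let supp := [set x | ~ exists2 d, 0 < d &
  forall y, `|y - x| < d -> tail_inf y = tail_inf x].

(** Otherwise [tail_inf] has derivative zero on []u, v[], and the mean value theorem gives equal
    values at both ends. *)
Let supp_between u v : u < v -> tail_inf u < tail_inf v ->
  exists2 x, supp x & u < x < v.
Proof.
move=> uv lt; apply: contrapT => nx.
have D x : x \in `]u, v[ -> is_derive x 1 tail_inf 0.
  move=> xuv; have [d d0 dP] : exists2 d, 0 < d &
      forall y, `|y - x| < d -> tail_inf y = tail_inf x.
    by apply: contrapT => sx; apply: nx; exists x => //; rewrite in_itv in xuv.
  apply: (@near_eq_is_derive _ _ _ (cst (tail_inf x))).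
  by apply/nbhs_distP; exists d => // y /dP.
have [|c _] := @MVT _ tail_inf (cst 0) _ _ uv D.
  exact: continuous_subspaceT tail_inf_continuous.
by rewrite mul0r => /eqP; rewrite subr_eq0 => /eqP E; rewrite E ltxx in lt.
Qed.

Let supp_perfect : perfect_set supp.
Proof.
apply/perfect_setP; split.
  rewrite -[supp]setCK; apply: open_closedC; rewrite openE => x.
  move=> /contrapT[d d0 dP]; apply/nbhs_distP; exists (d / 2); first lra.
  move=> y yx; apply; exists (d / 2); first lra.
  move=> z zy; rewrite (dP y) ?dP //; move: yx zy; rewrite !ltr_norml; lra.
(* Some [y] near [x] has a different value; by monotonicity [supp_between] applies and yields a
   support point strictly between the two. *)
move=> x d Sx d0; have [y yx ne] : exists2 y, `|y - x| < d & tail_inf y != tail_inf x.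
  apply: contrapT => ny; apply: Sx; exists d => // y yx; apply: contrapT => /eqP ?.
  by apply: ny; exists y.
have [xy|yx'|E] := ltgtP x y; last by rewrite E eqxx in ne.
  have [||z Sz /andP[xz zy]] := @supp_between x y => //.
    by rewrite lt_neqAle eq_sym ne tail_inf_mono// ltW.
  by exists z; split=> //; [rewrite gt_eqF|move: yx; rewrite !ltr_norml; lra].
have [||z Sz /andP[xz zy]] := @supp_between y x => //.
  by rewrite lt_neqAle ne tail_inf_mono// ltW.
by exists z; split=> //; [rewrite lt_eqF|move: yx; rewrite !ltr_norml; lra].
Qed.

(** If [tail_inf x < G x], then [G] stays above the midpoint of these two values near [x], so the
    infimum is decided further right and [tail_inf] is constant near [x]. *)
Let supp_attained x : supp x -> tail_inf x = G x.
Proof.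
move=> Sx; apply/eqP; rewrite eq_le tail_inf_le //=.
rewrite leNgt; apply/negP => lt; apply: Sx.
have /continuous_at_distP/(_ ((G x - tail_inf x) / 2))[|d d0 dG] := @G_cont x; first lra.
have {}dG y : `|y - x| < d -> (G x + tail_inf x) / 2 < G y.
  by move/dG; rewrite ltr_norml; lra.
exists d => // y yx; have [xy|yx'] := leP x y; apply/eqP; rewrite eq_le.
  rewrite (tail_inf_mono xy) andbT leNgt; apply/negP => lt2.
  (* Were [tail_inf y] larger than [tail_inf x], both terms of this minimum would exceed
     [tail_inf x]. *)
  have : Num.min (tail_inf y) ((G x + tail_inf x) / 2) <= tail_inf x.
    apply: (@le_tail_inf _ y); last by rewrite ge_min lexx.
    move=> t /andP[xt ty]; rewrite ge_min; apply/orP; right; apply: ltW; apply: dG.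
    by move: yx; rewrite !ltr_norml; lra.
  by rewrite ge_min => /orP[]; lra.
rewrite (tail_inf_mono (ltW yx')) /=; apply: (@le_tail_inf _ x) => // t /andP[yt tx].
have : `|t - x| < d by move: yx; rewrite !ltr_norml; lra.
by move=> /dG; lra.
Qed.

(** The level [m] forces [tail_inf a < tail_inf b], so the support is nonempty. At a support point
    [tail_inf x = G x]; if near [x] the values of [G] were at most [G x] on the right and at least
    [G x] on the left, [tail_inf] would be constant there. *)
Lemma perfect_increase_points a b m : a < b -> G a < m -> (forall t, b <= t -> m <= G t) ->
  exists A : set R, nonempty_perfect A /\
    forall x, A x -> ~ exists2 d, 0 < d &
      forall y, `|y - x| < d -> (y - x) * (G y - G x) <= 0.
Proof.
move=> ab Gam mG; exists supp; split.
  split; last exact: supp_perfect.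
  have [|x Sx _] := @supp_between a b ab; last by exists x.
  by apply: (le_lt_trans (tail_inf_le (lexx a))); apply: (lt_le_trans Gam); apply: lb_tail_inf.
move=> x Sx [d d0 dP]; have Ex := supp_attained Sx; apply: Sx; exists d => // y yx.
have [xy|yx'|->//] := ltgtP x y; apply/eqP; rewrite eq_le.
  rewrite (tail_inf_mono (ltW xy)) andbT Ex; apply: (le_trans (tail_inf_le (lexx y))).
  by have := dP _ yx; rewrite pmulr_rle0; lra.
rewrite (tail_inf_mono (ltW yx')) /=; apply: (@le_tail_inf _ x) => // t /andP[yt].
rewrite le_eqVlt Ex => /predU1P[->//|tx].
have /dP : `|t - x| < d by move: yx; rewrite !ltr_norml; lra.
by rewrite nmulr_rle0; lra.
Qed.

End RunningInfimum.

(** * Pointwise Lipschitz bounds as local estimates *)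

Lemma pointwise_lip_le {R : realType} (J : set R) (f : R -> R) (x C d : R) :
  0 < d ->
  (forall y, J y -> `|y - x| < d -> `|f y - f x| <= C * `|y - x|) ->
  (pointwise_lip J f x <= C%:E)%E.
Proof.
move=> d0 fC; rewrite /pointwise_lip /limf_esup.
pose V := [set y | [/\ J y, y != x & `|y - x| < d]].
apply: (@le_trans _ _ (ereal_sup [set (`|f y - f x| / `|y - x|)%:E | y in V])).
  apply: ereal_inf_lbound; exists V => //.
  by apply/nbhs_distP; exists d => // y yd yx Jy; split.
apply: ge_ereal_sup => _ [y [Jy yx yd] <-].
by rewrite lee_fin ler_pdivrMr ?normr_gt0 ?subr_eq0// fC.
Qed.

(** The limsup is an infimum over neighbourhoods, so strictness is what yields a single
    neighbourhood on which [C] bounds the quotients. *)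
Lemma pointwise_lip_lt {R : realType} (J : set R) (f : R -> R) (x C : R) :
  (pointwise_lip J f x < C%:E)%E ->
  exists2 d, 0 < d &
    forall y, J y -> `|y - x| < d -> `|f y - f x| <= C * `|y - x|.
Proof.
move=> /ereal_inf_lt[_ [V VF <-]] supV.
have /nbhs_distP[d d0 dV] := VF; exists d => // y Jy yd.
have [->|yx] := eqVneq y x; first by rewrite !subrr normr0 mulr0.
rewrite -ler_pdivrMr ?normr_gt0 ?subr_eq0// -lee_fin ltW//.
apply: le_lt_trans supV; apply: ereal_sup_ubound; exists y => //.
exact: dV.
Qed.

Lemma pointwise_lipN {R : realType} (J : set R) (f : R -> R) (x : R) :
  pointwise_lip J (\- f) x = pointwise_lip J f x.
Proof.
by rewrite /pointwise_lip; congr limf_esup; apply/funext => y /=; rewrite -opprD normrN.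
Qed.

(** * Constant extension from a compact interval *)

Definition clamp {R : realType} (a b x : R) : R := Num.max a (Num.min b x).

Section Clamp.
Context {R : realType} (a b : R).
Hypothesis ab : a <= b.

Lemma clamp_itv x : a <= clamp a b x <= b.
Proof. by rewrite /clamp le_max lexx /= ge_max ab ge_min lexx. Qed.

Lemma clamp_id x : a <= x <= b -> clamp a b x = x.
Proof. by move=> /andP[ax xb]; rewrite /clamp (min_idPr xb) (max_idPr ax). Qed.

Lemma clamp_ge x : b <= x -> clamp a b x = b.
Proof. by move=> bx; rewrite /clamp (min_idPl bx) (max_idPr ab). Qed.

Lemma clamp_le x : x <= a -> clamp a b x = a.
Proof. by move=> xa; rewrite /clamp (max_idPl _)// ge_min xa orbT. Qed.

Lemma clamp_mono x y : x <= y -> clamp a b x <= clamp a b y.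
Proof.
move=> xy; have [ya|/ltW ay] := leP y a.
  by rewrite clamp_le ?(le_trans xy)//; case/andP: (clamp_itv y).
have [xa|/ltW ax] := leP x a; first by rewrite clamp_le//; case/andP: (clamp_itv y).
have [bx|/ltW xb] := leP b x; first by rewrite !clamp_ge// (le_trans bx).
have [bY|/ltW yb] := leP b y; first by rewrite (clamp_ge bY); case/andP: (clamp_itv x).
by rewrite !clamp_id ?ax ?ay ?xb ?yb.
Qed.

Lemma clamp_dist x y : `|clamp a b y - clamp a b x| <= `|y - x|.
Proof.
wlog xy : x y / x <= y.
  move=> H; have [/H //|/ltW/H] := leP x y.
  by rewrite distrC [leRHS]distrC.
rewrite (ger0_norm (_ : 0 <= y - x)) ?subr_ge0//.
rewrite ger0_norm ?subr_ge0 ?clamp_mono//.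
have [ya|/ltW ay] := leP y a; first by rewrite !clamp_le ?(le_trans xy)//; lra.
have [xa|/ltW ax] := leP x a.
  rewrite (clamp_le xa); have [bY|/ltW yb] := leP b y.
    by rewrite (clamp_ge bY); lra.
  by rewrite clamp_id ?ay ?yb//; lra.
have [bx|/ltW xb] := leP b x; first by rewrite !clamp_ge ?(le_trans bx)//; lra.
rewrite (@clamp_id x) ?ax ?xb//.
have [bY|/ltW yb] := leP b y; first by rewrite (clamp_ge bY); lra.
by rewrite clamp_id ?ay ?yb.
Qed.

Lemma clamp_continuous : continuous (clamp a b).
Proof.
move=> x; apply/continuous_at_distP => e e0; exists e => // y.
exact: le_lt_trans (clamp_dist _ _).
Qed.

End Clamp.

Lemma is_interval_clamp {R : realType} (J : set R) (a b : R) : is_interval J ->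
  a <= b -> J a -> J b -> forall x, J (clamp a b x).
Proof. by move=> iJ ab Ja Jb x; apply: (iJ a b) => //; exact: clamp_itv. Qed.

(** Since [clamp a b] is 1-Lipschitz with values in [J], continuity relative to [J] becomes
    continuity on the whole line. *)
Lemma continuous_clamp {R : realType} (J : set R) (f : R -> R) (a b : R) :
  {within J, continuous f} -> a <= b -> (forall x, J (clamp a b x)) ->
  continuous (f \o clamp a b).
Proof.
move=> /subspace_continuousP fc ab Jc x; apply/continuous_at_distP => e e0.
have /cvgrPdist_lt/(_ e e0)/nbhs_distP[d d0 dP] := fc _ (Jc x).
exists d => // y yx; rewrite distrC; apply: dP => //.
exact: le_lt_trans (clamp_dist _ _ _) yx.
Qed.

(** * From a steep chord to a perfect set of bad points *)

Lemma perfect_not_lip_points {R : realType} (J : set R) (f : R -> R) (C a b : R) :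
  is_interval J -> {within J, continuous f} -> J a -> J b -> a < b ->
  C * (b - a) < f b - f a ->
  exists A : set R, nonempty_perfect A /\
    forall x, A x -> J x /\ ~ (pointwise_lip J f x <= C%:E)%E.
Proof.
move=> iJ fc Ja Jb ab steep; have ab' := ltW ab.
have Jc := is_interval_clamp iJ ab' Ja Jb.
(* Strictly between [C] and the chord slope: below the slope, so that [G a < G b]; above [C], so
   that a local estimate can be extracted. *)
pose C' := (C + (f b - f a) / (b - a)) / 2.
have ba0 : 0 < b - a by lra.
have Cq : C < (f b - f a) / (b - a) by rewrite ltr_pdivlMr.
have CC' : C < C' by rewrite /C'; lra.
have C'q : C' * (b - a) < f b - f a by rewrite -ltr_pdivlMr// /C'; lra.
pose G x := f (clamp a b x) - C' * clamp a b x.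
have Gc : continuous G.
  move=> x; apply: cvgB; first exact: (continuous_clamp fc ab' Jc).
  by apply: cvgM; [exact: cvg_cst|exact: clamp_continuous].
have G_clamp x : G (clamp a b x) = G x by rewrite /G (clamp_id (clamp_itv _ _)).
have G_lb : exists m, forall t, m <= G t.
  have [c _ cP] := @EVT_min R G a b ab' (continuous_subspaceT Gc).
  by exists (G c) => t; rewrite -(G_clamp t); apply: cP; rewrite in_itv /= clamp_itv.
have [||A [Ap AP]] := @perfect_increase_points R G G_lb Gc a b (G b) ab.
- rewrite /G clamp_le// clamp_ge//; lra.
- by move=> t bt; rewrite /G !clamp_ge.
exists A; split=> // x Ax.
(* Beyond either end [G] is locally constant, which the property of [A] rules out. *)
have xab : a <= x <= b.
  have [xa|ax] := ltP x a.
    exfalso; apply: (AP _ Ax); exists (a - x); first lra.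
    move=> y; rewrite ltr_norml => yx.
    have E : clamp a b y = clamp a b x by rewrite !clamp_le//; lra.
    by rewrite /G E subrr mulr0.
  have [bx|//] := ltP b x.
  exfalso; apply: (AP _ Ax); exists (x - b); first lra.
  move=> y; rewrite ltr_norml => yx.
  have E : clamp a b y = clamp a b x by rewrite !clamp_ge//; lra.
  by rewrite /G E subrr mulr0.
have xE := clamp_id xab; split; first by rewrite -xE.
move=> lip; have /pointwise_lip_lt[d d0 dP] : (pointwise_lip J f x < C'%:E)%E.
  by apply: (le_lt_trans lip); rewrite lte_fin.
apply: (AP _ Ax); exists d => // y yd.
(* The point [z] lies on the same side of [x] as [y], or equals [x]; the slope bound [C'] for [f] at
   [z] then says that [G] does not increase through [x]. *)
have := clamp_dist ab' x y; rewrite /G xE; set z := clamp a b y => zy.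
have := dP z (Jc y) (le_lt_trans zy yd).
have [xy|yx] := leP x y.
  have xz : x <= z by rewrite -xE clamp_mono.
  rewrite (ger0_norm (_ : 0 <= z - x)) ?subr_ge0// ler_norml => /andP[_ H].
  by rewrite mulr_ge0_le0 ?subr_ge0//; lra.
have zx : z <= x by rewrite -xE clamp_mono// ltW.
rewrite (ler0_norm (_ : z - x <= 0)) ?subr_le0// ler_norml => /andP[H _].
by rewrite mulr_le0_ge0 ?subr_le0//; lra.
Qed.

(** A chord rising faster than [C] would produce a perfect set of points violating the pointwise
    bound, necessarily inside [E]. Falling chords reduce to rising ones of [\- f]. *)
Lemma lip_of_no_perfect {R : realType} (J : set R) (f : R -> R) (C : R) (E : set R) :
  is_interval J -> {within J, continuous f} ->
  ~ (exists A : set R, A `<=` E /\ nonempty_perfect A) ->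
  (forall x, (J `\` E) x -> (pointwise_lip J f x <= C%:E)%E) ->
  forall x y, J x -> J y -> `|f y - f x| <= C * `|y - x|.
Proof.
move=> iJ fc nE lip.
have half (g : R -> R) : {within J, continuous g} ->
    (forall x, (J `\` E) x -> (pointwise_lip J g x <= C%:E)%E) ->
    forall x y, J x -> J y -> x < y -> g y - g x <= C * (y - x).
  move=> gc glip x y Jx Jy xy; rewrite leNgt; apply/negP => steep.
  have [A [Ap AP]] := perfect_not_lip_points iJ gc Jx Jy xy steep.
  apply: nE; exists A; split=> // t /AP[Jt nt].
  by apply: contrapT => Et; apply: nt; apply: glip.
have lt_case x y : J x -> J y -> x < y -> `|f y - f x| <= C * `|y - x|.
  move=> Jx Jy xy; rewrite (gtr0_norm (_ : 0 < y - x)) ?subr_gt0//.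
  rewrite ler_norml half// andbT.
  have Nfc : {within J, continuous (\- f)} by move=> z; apply: continuousN; apply: fc.
  have Nlip z : (J `\` E) z -> (pointwise_lip J (\- f)%R z <= C%:E)%E.
    by move/lip; rewrite pointwise_lipN.
  by have /= := half _ Nfc Nlip x y Jx Jy xy; lra.
move=> x y Jx Jy; have [xy|yx|->] := ltgtP x y; first exact: lt_case.
  by rewrite distrC (distrC y); apply: lt_case.
by rewrite !subrr normr0 mulr0.
Qed.

(** * Uniform limits and Cantor functions *)

Lemma geometric_uniform_limit {R : realType} (g : nat -> R -> R) :
  (forall n x, `|g n.+1 x - g n x| <= 2^-1 ^+ n) ->
  exists G : R -> R, forall n x, `|G x - g n x| <= 2 * 2^-1 ^+ n.
Proof.
(* [2 * 2^-1 ^+ n] is the sum of all step bounds from [n] on, so [low] increases and [up] decreases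
   with [n]. *)
move=> gS; pose low n x := g n x - 2 * 2^-1 ^+ n; pose up n x := g n x + 2 * 2^-1 ^+ n.
have low_le x : {homo low^~ x : m n / (m <= n)%N >-> m <= n}.
  apply: homo_leq => [//|? ? ?|n]; first exact: le_trans.
  by have := gS n x; rewrite /low exprS ler_norml; lra.
have up_ge x : {homo up^~ x : m n / (m <= n)%N >-> n <= m}.
  apply: homo_leq => [//|? ? ? ab bc|n]; first exact: le_trans bc ab.
  by have := gS n x; rewrite /up exprS ler_norml; lra.
have low_up m n x : low m x <= up n x.
  apply: (le_trans (low_le x _ _ (leq_maxl m n))).
  apply: le_trans (up_ge x _ _ (leq_maxr m n)).
  have : 0 < 2^-1 ^+ maxn m n :> R by rewrite exprn_gt0//; lra.
  by rewrite /low /up; lra.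
exists (fun x => sup (range (low^~ x))) => n x.
have l : low n x <= sup (range (low^~ x)).
  by apply: ub_le_sup; [exists (up 0 x) => _ [m _ <-]|exists n].
have u : sup (range (low^~ x)) <= up n x.
  by apply: ge_sup; [exists (low 0 x), 0%N|move=> _ [m _ <-]].
by move: l u; rewrite /low /up ler_norml; lra.
Qed.

Section CantorFunction.
Context {R : realType} (A : set R).
Variable next : R -> R -> R.
Hypothesis nextP : forall p r, A p -> 0 < r ->
  [/\ A (next p r), next p r != p & `|next p r - p| < r / 2].

(** A third of the distance between the centres keeps the child intervals disjoint; as that distance
    is below [r / 2], both stay inside the parent. *)
Let child_radius p r := `|next p r - p| / 3.

Let ramp (p r x : R) : R := clamp 0 1 ((x - (p - r)) / (2 * r)).

(* A stage carries its increase on [p - r, p + r]; half of it goes to each of two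
   disjoint subintervals, centred at [p] and at a second point of [A]. *)
Fixpoint cantor_stage (n : nat) (p r x : R) : R :=
  if n is m.+1 then
    (cantor_stage m p (child_radius p r) x +
     cantor_stage m (next p r) (child_radius p r) x) / 2
  else ramp p r x.

Let child_radius_gt0 p r : A p -> 0 < r -> 0 < child_radius p r.
Proof.
by move=> Ap r0; have [_ ne _] := nextP Ap r0; rewrite divr_gt0// normr_gt0 subr_eq0.
Qed.

Let child_radius_half p r : A p -> 0 < r -> child_radius p r <= r / 2.
Proof.
move=> Ap r0; have [_ _] := nextP Ap r0; rewrite /child_radius.
by have := normr_ge0 (next p r - p); lra.
Qed.

Let child_left p r x : A p -> 0 < r -> x <= p - r ->
  x <= p - child_radius p r /\ x <= next p r - child_radius p r.
Proof.
move=> Ap r0 xl; have [_ _] := nextP Ap r0; rewrite /child_radius.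
by case: (ger0P (next p r - p)); lra.
Qed.

Let child_right p r x : A p -> 0 < r -> p + r <= x ->
  p + child_radius p r <= x /\ next p r + child_radius p r <= x.
Proof.
move=> Ap r0 xl; have [_ _] := nextP Ap r0; rewrite /child_radius.
by case: (ger0P (next p r - p)); lra.
Qed.

Lemma cantor_stage_left n p r x : A p -> 0 < r -> x <= p - r ->
  cantor_stage n p r x = 0.
Proof.
elim: n p r => [|n IH] p r Ap r0 xl /=.
  by rewrite /ramp clamp_le// pmulr_lle0 ?invr_gt0; lra.
have [Aq _ _] := nextP Ap r0; have s0 := child_radius_gt0 Ap r0.
by have [l1 l2] := child_left Ap r0 xl; rewrite !IH// addr0 mul0r.
Qed.

Lemma cantor_stage_right n p r x : A p -> 0 < r -> p + r <= x ->
  cantor_stage n p r x = 1.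
Proof.
elim: n p r => [|n IH] p r Ap r0 xl /=.
  by rewrite /ramp clamp_ge// ler_pdivlMr; lra.
have [Aq _ _] := nextP Ap r0; have s0 := child_radius_gt0 Ap r0.
by have [l1 l2] := child_right Ap r0 xl; rewrite !IH//; lra.
Qed.

Lemma cantor_stage_continuous n p r : continuous (cantor_stage n p r).
Proof.
elim: n p r => [|n IH] p r x /=.
  apply: (@continuous_comp _ _ _ (fun x => (x - (p - r)) / (2 * r)) (clamp 0 1)).
    apply: cvgM; last exact: cvg_cst.
    by apply: cvgB; [exact: cvg_id|exact: cvg_cst].
  exact: clamp_continuous.
apply: cvgM; last exact: cvg_cst.
by apply: cvgD; exact: IH.
Qed.

(** By disjointness at most one child changes at [x], and it enters with weight one half, so each
    level halves the change. *)
Lemma cantor_stage_step n p r x : A p -> 0 < r ->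
  `|cantor_stage n.+1 p r x - cantor_stage n p r x| <= 2^-1 ^+ n.
Proof.
elim: n p r => [|n IH] p r Ap r0.
  have H y z : 0 <= clamp 0 1 y <= 1 -> 0 <= clamp 0 1 z <= 1 -> 0 <= ramp p r x <= 1 ->
      `|(clamp 0 1 y + clamp 0 1 z) / 2 - ramp p r x| <= 1 :> R.
    by rewrite ler_norml; lra.
  by apply: H; apply: clamp_itv.
have [Aq ne _] := nextP Ap r0; have s0 := child_radius_gt0 Ap r0.
have := IH _ _ Ap s0; have := IH _ _ Aq s0.
rewrite [cantor_stage n.+2 _ _ _]/= [cantor_stage n.+1 p r x]/= exprS.
set s := child_radius p r in s0 *; set q := next p r in Aq ne *.
rewrite -/(cantor_stage n.+1 p s x) -/(cantor_stage n.+1 q s x).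
have cancel u : A u -> s <= `|x - u| ->
    cantor_stage n.+1 u s x = cantor_stage n u s x.
  move=> Au; have [ux|xu] := leP u x.
    rewrite ger0_norm ?subr_ge0// => su.
    by rewrite !(cantor_stage_right _ Au s0)//; lra.
  rewrite ltr0_norm ?subr_lt0// => su.
  by rewrite !(cantor_stage_left _ Au s0)//; lra.
have [/(cancel _ Ap) ->|xp] := leP s `|x - p|; first by rewrite !ler_norml; lra.
(* The centres are [3 * s] apart, so a point within [s] of [p] is farther than [s] from [q]. *)
have /(cancel _ Aq) -> : s <= `|x - q|.
  have sE : s = `|q - p| / 3 by [].
  by have := ler_distD x q p; rewrite (distrC q x); lra.
by rewrite !ler_norml; lra.
Qed.

(** After [n] subdivisions the radii are at most [d], while every centre is in [A], hence at least
    [2 * d] from [x]. So [x] and [y] lie on the same side of each interval, whatever the number [m]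
    of further stages. *)
Lemma cantor_stage_locally_constant n m p r d x y : A p -> 0 < r ->
  (forall z, A z -> 2 * d <= `|z - x|) -> `|y - x| < d -> r <= 2 ^+ n * d ->
  cantor_stage (n + m) p r y = cantor_stage (n + m) p r x.
Proof.
move=> Ap r0 Ax yx; elim: n p r Ap r0 => [|n IH] p r Ap r0.
  rewrite expr0 mul1r add0n => rd; have := Ax _ Ap.
  move: yx; rewrite ltr_norml; case: (ger0P (p - x)) => _ ? ?.
    by rewrite !(cantor_stage_left _ Ap r0)//; lra.
  by rewrite !(cantor_stage_right _ Ap r0)//; lra.
rewrite exprS => rd /=; have [Aq _ _] := nextP Ap r0.
have s0 := child_radius_gt0 Ap r0; have := child_radius_half Ap r0 => sr.
by rewrite !IH//; lra.
Qed.

End CantorFunction.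

Lemma perfect_cantor_function {R : realType} (A : set R) (p r : R) :
  perfect_set A -> A p -> 0 < r ->
  exists G : R -> R, [/\ continuous G, G (p - r) = 0, G (p + r) = 1 &
    forall x, ~ A x -> exists2 d, 0 < d & forall y, `|y - x| < d -> G y = G x].
Proof.
move=> /perfect_setP[cA lA] Ap r0.
have /choice[next nextP] : forall pr : R * R, exists q, A pr.1 -> 0 < pr.2 ->
    [/\ A q, q != pr.1 & `|q - pr.1| < pr.2 / 2].
  (* The value [0] is a dummy for pairs that fail the premises. *)
  move=> [u v] /=; have [Au|nAu] := pselect (A u); last by exists 0.
  have [v0|v0] := ltP 0 v; last by exists 0; move: v0; rewrite leNgt => /negP.
  by have [||q ?] := lA u (v / 2) => //; [lra|exists q].
pose nx u v := next (u, v).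
have nxP u v : A u -> 0 < v -> [/\ A (nx u v), nx u v != u & `|nx u v - u| < v / 2].
  exact: nextP (u, v).
pose g n := cantor_stage nx n p r.
have [G GP] := @geometric_uniform_limit R g (fun n x => cantor_stage_step nxP n x Ap r0).
have small e : 0 < e -> exists N, forall n, (N <= n)%N -> 2 * 2^-1 ^+ n < e :> R.
  move=> e0; have /cvgrPdist_lt/(_ (e / 2))[|N _ NP] : 2^-1 ^+ n @[n --> \oo] --> (0 : R).
  - by apply: cvg_expr; rewrite ger0_norm; lra.
  - lra.
  exists N => n /NP; rewrite sub0r normrN ger0_norm ?exprn_ge0//; lra.
have eq_of_small a b : (forall e, 0 < e -> `|a - b| < e) -> a = b :> R.
  move=> ab; apply/eqP; rewrite -subr_eq0 -normr_le0 leNgt; apply/negP => /ab.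
  by rewrite ltxx.
exists G; split.
- move=> x; apply/continuous_at_distP => e e0.
  have [|N /(_ N (leqnn N)) NP] := small (e / 3); first lra.
  have /continuous_at_distP/(_ (e / 3))[|d d0 dP] := @cantor_stage_continuous R nx N p r x.
    lra.
  exists d => // y /dP; have := GP N x; have := GP N y; rewrite -/(g N).
  by rewrite !ler_norml !ltr_norml; lra.
- apply: eq_of_small => e /small[N /(_ N (leqnn N)) NP].
  by have := GP N (p - r); rewrite /g (cantor_stage_left nxP)// => /le_lt_trans; apply.
- apply: eq_of_small => e /small[N /(_ N (leqnn N)) NP].
  by have := GP N (p + r); rewrite /g (cantor_stage_right nxP)// => /le_lt_trans; apply.
move=> x nAx; have : open (~` A) by apply: closed_openC.
rewrite openE => /(_ x nAx)/nbhs_distP[d d0 dP].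
exists (d / 2); first lra.
move=> y yx; apply: eq_of_small => e e0.
have [|N NP] := small (e / 2); first lra.
(* [n] subdivisions make all stages from [n] on locally constant at [x]; the [N] further ones bring
   the stage within [e / 2] of [G]. *)
have [n rn] : exists n, r <= 2 ^+ n * (d / 2).
  have [|n /(_ n (leqnn n)) nP] := small (d / r); first by rewrite divr_gt0.
  exists n; rewrite -ler_pdivrMl ?exprn_gt0// -exprVn.
  by move: nP; rewrite ltr_pdivlMr//; lra.
have := @cantor_stage_locally_constant R A nx nxP n N p r (d / 2) x y Ap r0.
move=> /(_ _ yx rn) E; have := GP (n + N)%N x; have := GP (n + N)%N y.
rewrite /g E; last first.
  by move=> z Az; rewrite leNgt; apply/negP => zx; apply: (dP z) => //; lra.
have := NP _ (leq_addl n N).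
by rewrite !ler_norml !ltr_norml; lra.
Qed.

(** * Removability and perfect subsets *)

Lemma perfect_middle_point {R : realType} (A : set R) : nonempty_perfect A ->
  exists a p b, [/\ A a, A p, A b & a < p < b].
Proof.
move=> [[x Ax] /perfect_setP[_ lA]].
have [y [Ay yx _]] := lA x 1 Ax ltr01.
(* Being closer to [x] than [y] is, [z] is a third point of [A]; the middle one of the three serves
   as [p]. *)
have [|z [Az zx zy]] := lA x `|y - x| Ax; first by rewrite normr_gt0 subr_eq0.
have zneqy : z != y by apply: contraTneq zy => ->; rewrite ltxx.
have pick (u v w : R) : A u -> A v -> A w -> u < v -> v < w ->
    exists a p b, [/\ A a, A p, A b & a < p < b].
  by move=> *; exists u, v, w; split=> //; apply/andP.
have [xy|yx'|E] := ltgtP x y; last by rewrite E eqxx in yx.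
  have [xz|zx'|E] := ltgtP x z; last by rewrite E eqxx in zx.
    have [zy'|yz|E] := ltgtP z y; last by rewrite E eqxx in zneqy.
      exact: (pick x z y).
    exact: (pick x y z).
  exact: (pick z x y).
have [xz|zx'|E] := ltgtP x z; last by rewrite E eqxx in zx.
  exact: (pick y x z).
have [zy'|yz|E] := ltgtP z y; last by rewrite E eqxx in zneqy.
  exact: (pick z y x).
exact: (pick y z x).
Qed.

Theorem mainTheorem2 (R : realType) (J : set R) (C : R) (E : set R)
    (hJ : nondegenerate_interval J) (hC : 0 <= C) (hE : E `<=` J) :
  removable_lip J C E <->
  ~ (exists A : set R, A `<=` E /\ nonempty_perfect A).
Proof.
have [iJ _] := hJ; split; last first.
  move=> nE f fc lip x Jx; apply: (pointwise_lip_le ltr01) => y Jy _.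
  exact: lip_of_no_perfect nE lip x y Jx Jy.
move=> rem [A [AE Ap]].
have [a [p [b [Aa App Ab /andP[ap pb]]]]] := perfect_middle_point Ap.
(* Keeps [[p - r, p + r]] inside [[a, b]], hence inside [J]. *)
pose r := Num.min (p - a) (b - p).
have r0 : 0 < r by rewrite lt_min; lra.
have [ra rb] : r <= p - a /\ r <= b - p by rewrite !ge_min !lexx orbT.
have [G [Gc Gl Gr Gloc]] := perfect_cantor_function Ap.2 App r0.
have Ju u : a <= u <= b -> J u by apply: iJ; apply/hE/AE.
(* One more than the rise a [C]-Lipschitz function can have over length [2 * r]. *)
pose K : R := 2 * r * C + 1; pose F (x : R) : R := K * G x.
have fc : {within J, continuous F}.
  apply: continuous_subspaceT => x; by apply: cvgM; [exact: cvg_cst|exact: Gc].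
have lip x : J x -> (pointwise_lip J F x <= C%:E)%E.
  (* Off [E], hence off [A], the function [F] is locally constant. *)
  apply: rem x => // x [Jx nEx].
  have [d d0 dP] := Gloc x (contra_not (AE x) nEx).
  apply: (pointwise_lip_le d0) => y _ /dP; rewrite /F => ->.
  by rewrite subrr normr0 mulr_ge0.
have no : ~ (exists B : set R, B `<=` set0 /\ nonempty_perfect B).
  by move=> [B [B0 [[z /B0]]]].
have Jl : J (p - r) by apply: Ju; lra.
have Jr : J (p + r) by apply: Ju; lra.
have := lip_of_no_perfect iJ fc no (fun x Jx => lip x Jx.1) Jl Jr.
rewrite /F Gl Gr mulr0 subr0 mulr1 opprD opprK addrACA subrr add0r.
rewrite !ger0_norm /K ?addr_ge0 ?mulr_ge0//; lra.
Qed.
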